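(* Let $B$ be a finite Blaschke product with $N\ge2$ zeros counted with multiplicity. There is a non-contractive unital representation $\pi$ of $\mathcal A_B$ (respectively, of $\mathcal A_B^0$) on a Hilbert space which maps the generators to contractions.
   Context: $A(\mathbb D)$ is the disk algebra. $\mathcal A_B=\mathbb C+B\,A(\mathbb D)$ with the supremum norm; its generators are $B,zB,\dots,z^{N-1}B$. $\mathcal A_B^0$ is the closed unital subalgebra of $\mathcal A_B$ generated by $B$ and $zB$; its generators are $B$ and $zB$. A representation $\pi$ of $\mathcal A$ into $\mathcal B(\mathcal H)$ ($\mathcal H$ a Hilbert space) is contractive if $\|\pi(f)\|\le\|f\|_\infty$ for all $f\in\mathcal A$; a contraction is an operator of norm at most $1$. *)

(* Defs.v *)
From HB Require Import structures.
From mathcomp Require Import all_boot all_order all_algebra sesquilinear.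
From mathcomp Require Import all_classical all_reals all_analysis.
From mathcomp Require Import complex.

Set Implicit Arguments.
Unset Strict Implicit.
Unset Printing Implicit Defensive.

Import Order.TTheory GRing.Theory Num.Theory.
Import numFieldNormedType.Exports.

Local Open Scope classical_set_scope.
Local Open Scope ring_scope.

(* R[i] as a normed module over itself: this gives it its usual topology and
   makes [derivable f z 1] complex differentiability at z. *)
HB.instance Definition _ (R : realType) := NormedModule.copy R[i] (R[i])^o.

(* Norms of modules over R[i] take their values in R[i]; suprema are taken in
   R. *)
Definition rnorm (R : realType) (V : normedModType R[i]) (x : V) : R :=
  complex.Re `|x|.

Section DiskAlgebras.
Variable R : realType.
Implicit Types (f g B : R[i] -> R[i]) (A S : set (R[i] -> R[i])).

(* An element of a function algebra on the closed disk is represented by any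
   total function with the right values on the closed disk; all notions below
   depend on these values only. *)
Definition closed_disk : set R[i] := [set z | `|z| <= 1].

Definition open_disk : set R[i] := [set z | `|z| < 1].

Definition sup_norm f : R := sup [set rnorm (f z) | z in closed_disk].

Definition disk_algebra : set (R[i] -> R[i]) :=
  [set f | {within closed_disk, continuous f} /\
           forall z, open_disk z -> derivable f z 1].

Definition blaschke (N : nat) (c : R[i]) (a : 'I_N -> R[i]) : R[i] -> R[i] :=
  fun z => c * \prod_(i < N) ((z - a i) / (1 - (a i)^* * z)).

Definition is_blaschke (N : nat) B : Prop :=
  exists (c : R[i]) (a : 'I_N -> R[i]),
    [/\ `|c| = 1, forall i, open_disk (a i) &
        forall z, closed_disk z -> B z = blaschke c a z].

Definition algB B : set (R[i] -> R[i]) :=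
  [set f | exists (c : R[i]) (g : R[i] -> R[i]), disk_algebra g /\
           forall z, closed_disk z -> f z = c + B z * g z].

Definition algB_generators (N : nat) B : set (R[i] -> R[i]) :=
  [set (fun z => z ^+ j * B z) | j in [set j | (j < N)%N]].

(* Closedness is with respect to the supremum norm of A. *)
Record closed_unital_subalgebra A S : Prop := ClosedUnitalSubalgebra {
  subalg_sub : S `<=` A ;
  subalg_one : S (cst 1) ;
  subalg_linear : forall (k : R[i]) f g, S f -> S g -> S (k \*: f \+ g) ;
  subalg_mul : forall f g, S f -> S g -> S (f \* g) ;
  subalg_closed : forall f, A f ->
    (forall e : R, 0 < e -> exists2 g, S g & sup_norm (f \- g) < e) -> S f }.

Definition algB0_generators B : set (R[i] -> R[i]) :=
  [set B; (fun z => z * B z)].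

Definition algB0 B : set (R[i] -> R[i]) :=
  smallest (closed_unital_subalgebra (algB B)) (algB0_generators B).

End DiskAlgebras.

(* The inner product is linear in its first argument. *)
Record hilbertSpace (R : realType) := HilbertSpace {
  hilbert_sort :> completeNormedModType R[i] ;
  hilbert_dot : {dot hilbert_sort for Num.conj} ;
  hilbert_normE : forall x : hilbert_sort, `|x| ^+ 2 = hilbert_dot x x }.

Section Representations.
Variables (R : realType) (H : hilbertSpace R).
Implicit Types (A : set (R[i] -> R[i])) (T : H -> H).
Implicit Types (pi : (R[i] -> R[i]) -> (H -> H)).

Definition bounded_operator T : Prop := linear T /\ continuous T.

Definition op_norm T : R := sup [set rnorm (T x) | x in [set x | `|x| <= 1]].

Definition contraction_operator T : Prop := bounded_operator T /\ op_norm T <= 1.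

(* A unital representation of the function algebra A is a bounded unital
   homomorphism from A into B(H). The values of pi outside A are irrelevant,
   and rep_ext makes pi depend on the restrictions to the closed disk only. *)
Record unital_representation A pi : Prop := UnitalRepresentation {
  rep_operator : forall f, A f -> bounded_operator (pi f) ;
  rep_ext : forall f g, A f -> A g ->
    (forall z, closed_disk z -> f z = g z) -> pi f = pi g ;
  rep_one : forall x, pi (cst 1) x = x ;
  rep_linear : forall (k : R[i]) f g, A f -> A g ->
    forall x, pi (k \*: f \+ g) x = k *: pi f x + pi g x ;
  rep_mul : forall f g, A f -> A g -> forall x, pi (f \* g) x = pi f (pi g x) ;
  rep_bounded : exists M : R,
    forall f, A f -> op_norm (pi f) <= M * sup_norm f }.

Definition contractive_representation A pi : Prop :=
  forall f, A f -> op_norm (pi f) <= sup_norm f.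

End Representations.

(* Main.v *)
Require Import Defs.
From HB Require Import structures.
From mathcomp Require Import all_boot all_order all_algebra.
From mathcomp Require Import separable sesquilinear spectral.
From mathcomp Require Import all_classical all_reals all_analysis.
From mathcomp Require Import complex ring lra.

Set Implicit Arguments.
Unset Strict Implicit.
Unset Printing Implicit Defensive.

Import Order.TTheory GRing.Theory Num.Theory.
Import numFieldNormedType.Exports.

Local Open Scope classical_set_scope.
Local Open Scope ring_scope.

(** A representation is obtained from any finite set of points of the disk: let
    f act on C^n as the diagonal matrix of its values at the points, written in
    a basis that need not be orthogonal.  Point evaluations are bounded by the
    supremum norm, so such a representation is automatically bounded.  The work
    is to choose points and a basis for which B, zB, ..., z^(N-1) B become contractions while some other
    function of the algebra does not.

    The model to imitate is a derivation at the zeros of B.  Modulo B^2 A(D),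
    the algebra A_B is C + B (A(D) / B A(D)) with square-zero second summand,
    so every functional l on the N-dimensional space A(D) / B A(D) gives a
    representation c + B g |-> [[c, l(g)], [0, c]].  Let l(g) be the value at 1
    of the polynomial of degree less than N that interpolates g at the zeros of
    B.  Then l(z^j) = 1 for all j < N, so the generators are sent to matrices
    of norm 1.  Were l contractive, l(1) = l(z) = 1 would force it to be the
    evaluation at 1; but l(B) = 0 whereas |B(1)| = 1.  Explicitly, with
    beta = B(1), the function
        g = (1 + z) / 2 - d conj(beta) (B - beta)
    has l(g) = 1 + d.  As |B(z) - beta| <= K |1 - z| / 2 on the disk, the
    choice d = K^-2 and the parallelogram identity for 1 + z and 1 - z give
    |g| <= 1 + d / 2 ([test_factor_bound]).  The function B g is a polynomial
    in B and zB without constant term, so it lies in the smaller algebra too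
    ([test_function_algB0]), and one representation serves both algebras.

    When B has multiple zeros, l involves derivatives.  To keep to point
    evaluations, the zeros are replaced by a nearby fibre: for all but finitely
    many eps in ]0, 1[, the equation B = eps has N distinct solutions w_i, all in the
    disk ([blaschke_fibre]).  The points used are one zero of B and
    w_1, ..., w_N.  On the polynomials of degree less than N, multiplication by
    g modulo the product of the X - w_i is a matrix [poly_calculus g], and in
    the basis [fibre_basis] a function B g becomes the block matrix
        [[0, 0], [l(g), eps * poly_calculus g]]
    ([fibre_basis_conj]).  Two perturbations make the generators contractive in
    the Euclidean norm: l is multiplied by a constant tau < 1, and the
    monomials z, ..., z^(N-1) are rescaled by a small mu, so that only l(z^j)
    survives in the row block; then eps is taken small compared with mu.  The
    bounds involved are uniform in eps because the product of the X - w_i has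
    coefficients of modulus at most 2^N ([exists_fibre_matrices]).  The gap
    between 1 + d / 2 and 1 + d absorbs both perturbations
    ([gap_inequality]). *)

(** * The Frobenius norm *)

Section FrobeniusNorm.
Variable C : numClosedFieldType.

(** Taking the Hermitian norm of the vectorization makes the triangle inequality
    and homogeneity those of a dot product; on row vectors it is the Euclidean
    norm. *)
Definition fnorm m n (A : 'M[C]_(m, n)) : C :=
  sqrtC (dotmx (mxvec A) (mxvec A)).

Lemma fnorm_ge0 m n (A : 'M[C]_(m, n)) : 0 <= fnorm A.
Proof. by rewrite sqrtC_ge0 dnorm_ge0. Qed.

Lemma fnorm_sqr m n (A : 'M[C]_(m, n)) :
  fnorm A ^+ 2 = \sum_i \sum_j `|A i j| ^+ 2.
Proof.
rewrite sqrtCK dotmxE mxE pair_bigA /=.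
rewrite (reindex _ (curry_mxvec_bij _ _)) /=; apply: eq_bigr => -[i j] _ /=.
by rewrite !mxE mxvecE normCK.
Qed.

Lemma fnormD m n (A B : 'M[C]_(m, n)) : fnorm (A + B) <= fnorm A + fnorm B.
Proof.
by rewrite /fnorm linearD; have [] := triangle_lerif (@dotmx C _) (mxvec A) (mxvec B).
Qed.

Lemma fnormZ m n (k : C) (A : 'M[C]_(m, n)) : fnorm (k *: A) = `|k| * fnorm A.
Proof.
by rewrite /fnorm linearZ dnormZ sqrtCM ?nnegrE ?exprn_ge0 ?dnorm_ge0 ?sqrCK.
Qed.

Lemma fnorm_eq0 m n (A : 'M[C]_(m, n)) : fnorm A = 0 -> A = 0.
Proof. by move/eqP; rewrite sqrt_dnorm_eq0 mxvec_eq0 => /eqP. Qed.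

Lemma fnorm_row_sqr n (u : 'rV[C]_n) : fnorm u ^+ 2 = \sum_j `|u 0 j| ^+ 2.
Proof. by rewrite fnorm_sqr big_ord1. Qed.

Lemma fnorm_coord n (u : 'rV[C]_n) j : `|u 0 j| <= fnorm u.
Proof.
rewrite -ler_sqr ?nnegrE ?fnorm_ge0// fnorm_row_sqr (bigD1 j)//= lerDl.
by apply: sumr_ge0 => *; rewrite exprn_ge0.
Qed.

Lemma fnorm_le_sum n (u : 'rV[C]_n) : fnorm u <= \sum_j `|u 0 j|.
Proof.
rewrite -ler_sqr ?nnegrE ?fnorm_ge0 ?sumr_ge0// fnorm_row_sqr expr2 mulr_suml.
apply: ler_sum => i _; rewrite expr2 ler_wpM2l//.
by rewrite (bigD1 i)//= lerDl sumr_ge0.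
Qed.

(** Each entry of the product is a dot product, bounded by Cauchy-Schwarz. *)
Lemma fnormM m n p (A : 'M[C]_(m, n)) (B : 'M[C]_(n, p)) :
  fnorm (A *m B) <= fnorm A * fnorm B.
Proof.
rewrite -ler_sqr ?nnegrE ?mulr_ge0 ?fnorm_ge0// exprMn !fnorm_sqr.
rewrite [X in _ <= _ * X]exchange_big /= mulr_suml; apply: ler_sum => i _.
rewrite mulr_sumr; apply: ler_sum => j _.
pose u := row i A; pose v := map_mx Num.conj (col j B)^T.
have -> : (A *m B) i j = dotmx u v.
  by rewrite dotmxE !mxE; apply: eq_bigr => k _; rewrite !mxE conjCK.
have : `|dotmx u v| ^+ 2 <= dotmx u u * dotmx v v.
  by have [] := CauchySchwarz (@dotmx C _) u v.
move=> /le_trans; apply; rewrite !dotmxE !mxE; apply: ler_pM.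
- by apply: sumr_ge0 => k _; rewrite !mxE mul_conjC_ge0.
- by apply: sumr_ge0 => k _; rewrite !mxE mul_conjC_ge0.
- by apply: ler_sum => k _; rewrite !mxE normCK.
- by apply: ler_sum => k _; rewrite !mxE conjCK normCK mulrC.
Qed.

Lemma fnorm_le_entries n (A : 'M[C]_n) (b : C) : 0 <= b ->
  (forall i j, `|A i j| <= b) -> fnorm A <= n%:R * b.
Proof.
move=> b0 Ab; rewrite -ler_sqr ?nnegrE ?mulr_ge0 ?fnorm_ge0// fnorm_sqr.
apply: le_trans (_ : \sum_(i < n) \sum_(j < n) b ^+ 2 <= _).
  by apply: ler_sum => i _; apply: ler_sum => j _; rewrite lerXn2r ?nnegrE.
by rewrite !sumr_const card_ord -mulrnA -[leLHS]mulr_natl natrM exprMn -expr2.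
Qed.

Lemma fnorm_col_sqr n (u : 'cV[C]_n) : fnorm u ^+ 2 = \sum_i `|u i 0| ^+ 2.
Proof. by rewrite fnorm_sqr; apply: eq_bigr => i _; rewrite big_ord1. Qed.

Lemma fnorm_expr n (A : 'M[C]_n.+1) k : fnorm (A ^+ k.+1) <= fnorm A ^+ k.+1.
Proof.
elim: k => [|k IHk]; first by rewrite !expr1.
rewrite exprS [X in _ <= X]exprS (le_trans (fnormM _ _))//.
by rewrite ler_wpM2l ?fnorm_ge0.
Qed.

(** The images of the functions that vanish at the chosen zero of the Blaschke
    product have this shape. *)
Lemma fnorm_lower_rows m n (X : 'M[C]_(n, m)) (Y : 'M[C]_n) :
  fnorm (block_mx (0 : 'M[C]_m) 0 X Y) ^+ 2 = fnorm X ^+ 2 + fnorm Y ^+ 2.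
Proof.
rewrite !fnorm_sqr big_split_ord /= big1 ?add0r => [|i _]; last first.
  by apply: big1 => j _; rewrite block_mxEv col_mxEu row_mx0 mxE normr0 expr0n.
rewrite -big_split /=; apply: eq_bigr => i _.
rewrite big_split_ord /=; congr (_ + _); apply: eq_bigr => j _.
  by rewrite block_mxEdl.
by rewrite block_mxEdr.
Qed.

End FrobeniusNorm.

(** * Finite-dimensional Hilbert spaces *)

Section EuclideanSpace.
Variables (R : realType) (n : nat).

(** A copy of the row vectors: the norm already attached to matrices is the
    maximum of the entries, which does not come from a dot product. *)
Definition euclid := 'rV[R[i]]_n.

HB.instance Definition _ := GRing.Lmodule.copy euclid 'rV[R[i]]_n.
HB.instance Definition _ := @Lmodule_isNormed.Build R[i] euclid
  (@fnorm R[i] 1 n) (@fnormD _ 1 n) (@fnormZ _ 1 n) (@fnorm_eq0 _ 1 n).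

Lemma euclid_normE (x : euclid) : `|x| = fnorm x. Proof. by []. Qed.

Lemma normc_ge_Im (z : R[i]) : `|complex.Im z|%:C%C <= `|z|.
Proof. by rewrite normc_def lecR -sqrtr_sqr ler_wsqrtr// lerDr sqr_ge0. Qed.

Lemma normc_le_ReIm (z : R[i]) :
  `|z| <= (`|complex.Re z| + `|complex.Im z|)%:C%C.
Proof.
rewrite {1}[z]complexE (le_trans (ler_normD _ _))// normrM.
by rewrite !normc_def /= !expr0n /= !addr0 add0r expr1n sqrtr1 !sqrtr_sqr rmorphD mul1r.
Qed.

Lemma gt0_real_complex (e : R[i]) : 0 < e -> exists2 r : R, 0 < r & e = r%:C%C.
Proof. by case: e => a b; rewrite ltcE /= => /andP[/eqP-> ?]; exists a. Qed.

(** Completeness is inherited from R, through the real and imaginary parts of the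
    coordinates. *)
Lemma euclid_complete (F : set_system euclid) :
  ProperFilter F -> cauchy F -> cvg F.
Proof.
move=> FF /cauchyP Fc.
have cvgR (p : R[i] -> R) : {morph p : x y / x - y} ->
    (forall z, `|p z|%:C%C <= `|z|) -> forall i, cvg ((fun x : euclid => p (x 0 i)) @ F).
  move=> pB p_le i; apply/cauchy_cvgP/cauchyP => e e0.
  have [|x Fx] := Fc e%:C%C; first by rewrite ltcR.
  exists (p (x 0 i)); apply: (@filterS _ F _ _ (fun y => ball _ _ (p (y 0 i))) _ Fx) => y.
  rewrite -!ball_normE /ball_ /= euclid_normE => xy.
  rewrite -pB -ltcR (le_lt_trans (p_le _))// (le_lt_trans _ xy)//.
  by have := fnorm_coord (x - y : 'rV_n) i; rewrite !mxE.
have cRe := cvgR (@complex.Re R) (raddfB _) (@normc_ge_Re R).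
have cIm := cvgR (@complex.Im R) (raddfB _) normc_ge_Im.
pose l : euclid := \row_i Complex (lim ((fun x : euclid => complex.Re (x 0 i)) @ F))
  (lim ((fun x : euclid => complex.Im (x 0 i)) @ F)).
apply/cvg_ex; exists l; apply/cvgrPdist_lt => _ /gt0_real_complex[e e0 ->].
(* The n coordinates have two parts each; n + 1 makes the final bound strict
   and covers n = 0. *)
pose d := e / (n.+1)%:R / 2.
have d0 : 0 < d by rewrite !divr_gt0.
have near_l i : F [set x : euclid |
    `|complex.Re (l 0 i - x 0 i)| < d /\ `|complex.Im (l 0 i - x 0 i)| < d].
  have /cvgrPdist_lt/(_ _ d0) Re_l := cRe i.
  have /cvgrPdist_lt/(_ _ d0) Im_l := cIm i.
  apply: filterS2 Re_l Im_l => x /=; rewrite !raddfB /= mxE /=; by split.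
have {}near_l : F [set x : euclid | forall i,
    `|complex.Re (l 0 i - x 0 i)| < d /\ `|complex.Im (l 0 i - x 0 i)| < d].
  exact: (@filter_forall _ _ _ F filter_filter near_l).
suff: F [set x : euclid | `|l - x| < e%:C%C] by [].
have FF' : Filter F by exact: filter_filter.
refine (filterS _ near_l) => x {}near_l.
rewrite /mkset euclid_normE.
rewrite (le_lt_trans (fnorm_le_sum _))//.
have -> : e = (d + d) *+ n.+1.
  by rewrite /d -splitr -mulr_natr divfK.
rewrite mulrSr rmorphD /= ltr_pwDr ?ltcR ?addr_gt0//.
rewrite -[n in _ *+ n]card_ord -sumr_const rmorph_sum /=.
apply: ler_sum => i _; have [dRe dIm] := near_l i.
by rewrite mxE [X in _ + X]mxE (le_trans (normc_le_ReIm _))// lecR; apply: lerD; exact: ltW.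
Qed.

HB.instance Definition _ := Uniform_isComplete.Build euclid euclid_complete.

Definition edot (x y : euclid) : R[i] := dotmx (x : 'rV_n) (y : 'rV_n).
HB.instance Definition _ := Dot.copy edot (@dotmx R[i] n).

Lemma edot_normE (x : euclid) : `|x| ^+ 2 = edot x x.
Proof. 
rewrite euclid_normE fnorm_row_sqr /edot dotmxE mxE.
by apply: eq_bigr => i _; rewrite !mxE normCK.
Qed.

Definition euclid_hilbert : hilbertSpace R :=
  @HilbertSpace R euclid (edot : {dot euclid for Num.conj}) edot_normE.

(** Row vectors are acted on from the right, so composition of operators reverses
    the matrix product. *)
Definition row_action (A : 'M[R[i]]_n) (x : euclid) : euclid := x *m A.

Lemma row_action_bound A x : `|row_action A x| <= fnorm A * `|x|.
Proof. by rewrite !euclid_normE mulrC fnormM. Qed.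

Lemma row_action_linear A : linear (row_action A).
Proof. by move=> k x y; rewrite /row_action mulmxDl -scalemxAl. Qed.

Lemma row_action_continuous A : continuous (row_action A).
Proof.
move=> x; have nbhs_x : Filter (nbhs x) by exact: nbhs_filter.
apply/(@cvgrPdist_lt _ euclid _ (nbhs x)) => e e0.
have A1 : 0 < fnorm A + 1 by rewrite ltr_wpDl ?fnorm_ge0.
apply/nbhs_ballP; exists (e / (fnorm A + 1)) => /=; first by rewrite divr_gt0.
move=> y; rewrite -ball_normE /= ltr_pdivlMr// => xy.
rewrite (_ : _ - _ = row_action A (x - y)); last by rewrite /row_action mulmxBl.
apply: le_lt_trans (row_action_bound _ _) _; apply: le_lt_trans xy.
by rewrite mulrC ler_wpM2l// lerDl.
Qed.

Lemma row_action_bounded A : @bounded_operator R euclid_hilbert (row_action A).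
Proof. by split; [exact: row_action_linear|exact: row_action_continuous]. Qed.

Lemma rnormE (V : normedModType R[i]) (x : V) : (rnorm x)%:C%C = `|x|.
Proof. by rewrite /rnorm RRe_real// normr_real. Qed.

Lemma row_action_has_sup A :
  has_sup [set rnorm (row_action A x) | x in [set x : euclid_hilbert | `|x| <= 1]].
Proof.
split; first by exists (rnorm (row_action A 0)), 0 => //=; rewrite normr0.
exists (complex.Re (fnorm A)) => _ [x /= x1 <-].
rewrite -lecR rnormE RRe_real ?ger0_real ?fnorm_ge0//.
by rewrite (le_trans (row_action_bound _ _))// ler_piMr ?fnorm_ge0.
Qed.

(** The operator norm is at most the Frobenius norm, which is computable from the
    entries. *)
Lemma op_norm_row_action_le A (M : R) : fnorm A <= M%:C%C ->
  @op_norm R euclid_hilbert (row_action A) <= M.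
Proof.
move=> AM; apply: ge_sup; first by have [] := row_action_has_sup A.
move=> _ [x /= x1 <-]; rewrite -lecR rnormE (le_trans _ AM)//.
by rewrite (le_trans (row_action_bound _ _))// ler_piMr ?fnorm_ge0.
Qed.

Lemma op_norm_row_action_ge A (x : euclid) : `|x| <= 1 ->
  `|row_action A x| <= (@op_norm R euclid_hilbert (row_action A))%:C%C.
Proof.
move=> x1; rewrite -rnormE lecR; apply: sup_upper_bound.
  exact: row_action_has_sup.
by exists x.
Qed.

End EuclideanSpace.

(** * Estimates for finite Blaschke products *)

Section BlaschkeEstimates.
Variable C : numClosedFieldType.

(** The sign of the right-hand side decides whether a Blaschke factor has modulus
    below or above 1, inside and outside the disk. *)
Lemma blaschke_factor_identity (a z : C) :
  `|1 - a^* * z| ^+ 2 - `|z - a| ^+ 2 = (1 - `|a| ^+ 2) * (1 - `|z| ^+ 2).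
Proof. by rewrite !normCK !(rmorphB, rmorphM, rmorph1) /= conjCK; ring. Qed.

Lemma blaschke_den_neq0 (a z : C) : `|a| < 1 -> `|z| <= 1 -> 1 - a^* * z != 0.
Proof.
move=> a1 z1; rewrite subr_eq0; apply/eqP => /(congr1 Num.norm).
rewrite normr1 normrM norm_conjC => az; move: (ltxx (1 : C)).
by rewrite {1}az (le_lt_trans _ a1)// ler_piMr.
Qed.

Lemma blaschke_factor_le1 (a z : C) : `|a| < 1 -> `|z| <= 1 ->
  `|(z - a) / (1 - a^* * z)| <= 1.
Proof.
move=> a1 z1; rewrite normrM normfV.
rewrite ler_pdivrMr ?normr_gt0 ?blaschke_den_neq0// mul1r.
rewrite -ler_sqr ?nnegrE// -subr_ge0 blaschke_factor_identity.
by rewrite mulr_ge0// subr_ge0 expr_le1// ltW.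
Qed.

Lemma blaschke_factor_at1 (a : C) : `|a| < 1 -> `|(1 - a) / (1 - a^* * 1)| = 1.
Proof.
move=> a1; rewrite mulr1 normrM normfV.
have -> : 1 - a^* = (1 - a)^* by rewrite rmorphB rmorph1.
rewrite norm_conjC.
by rewrite divff// normr_eq0 subr_eq0; apply: contraTneq a1 => <-; rewrite normr1 ltxx.
Qed.

(** The difference is (z - 1) times (1 - |a|^2) over a product of two denominators,
    each of modulus at least 1 - |a|. *)
Lemma blaschke_factor_lipschitz (a : C) : `|a| < 1 -> exists2 L : C, 0 <= L &
  forall z, `|z| <= 1 ->
    `|(z - a) / (1 - a^* * z) - (1 - a) / (1 - a^* * 1)| <= L * `|1 - z|.
Proof.
move=> a1; have a0 : 0 < 1 - `|a| by rewrite subr_gt0.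
exists (`|1 - a * a^*| / (1 - `|a|) ^+ 2).
  by rewrite divr_ge0 ?exprn_ge0// ltW.
have den z : `|z| <= 1 -> 1 - `|a| <= `|1 - a^* * z|.
  move=> z1; apply: le_trans (lerB_dist _ _).
  by rewrite normr1 lerD2l lerN2 normrM norm_conjC ler_piMr.
have den0 z := @blaschke_den_neq0 a z a1.
move=> z z1; have o1 : `|1 : C| <= 1 by rewrite normr1.
have -> : (z - a) / (1 - a^* * z) - (1 - a) / (1 - a^* * 1) =
    - ((1 - a * a^*) * (1 - z)) / ((1 - a^* * z) * (1 - a^* * 1)).
  by field; apply/andP; split; [have := den0 1 o1; rewrite mulr1|exact: den0].
rewrite normrM normrN normrM normfV normrM mulrAC.
apply: ler_wpM2r => //; apply: ler_wpM2l => //.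
rewrite lef_pV2 ?posrE ?exprn_gt0 ?mulr_gt0 ?normr_gt0 ?den0// expr2.
by apply: ler_pM; rewrite ?den// ltW.
Qed.

(** Telescoping: the factors are exchanged one at a time, the others having
    modulus at most 1. *)
Lemma prod_dist_le (I : Type) (s : seq I) (x y : I -> C) :
  (forall i, `|x i| <= 1) -> (forall i, `|y i| <= 1) ->
  `|\prod_(i <- s) x i - \prod_(i <- s) y i| <= \sum_(i <- s) `|x i - y i|.
Proof.
move=> x1 y1; elim: s => [|i s IHs]; first by rewrite !big_nil subrr normr0.
rewrite !big_cons; set p := \prod_(j <- s) x j; set q := \prod_(j <- s) y j.
have -> : x i * p - y i * q = (x i - y i) * p + y i * (p - q) by ring.
rewrite (le_trans (ler_normD _ _))// !normrM lerD//.
  by rewrite ler_piMr// normr_prod prodr_ile1// => j _; rewrite normr_ge0 x1.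
by rewrite (le_trans _ IHs)// ler_piMl.
Qed.

Lemma blaschke_product_lipschitz N (c : C) (a : 'I_N -> C) :
  `|c| = 1 -> (forall i, `|a i| < 1) -> exists2 L : C, 0 <= L &
  forall z, `|z| <= 1 ->
    `|c * \prod_(i < N) ((z - a i) / (1 - (a i)^* * z)) -
      c * \prod_(i < N) ((1 - a i) / (1 - (a i)^* * 1))| <= L * `|1 - z|.
Proof.
move=> c1 a1; pose L_ i := projT1 (cid2 (blaschke_factor_lipschitz (a1 i))).
have L_ge0 i : 0 <= L_ i by rewrite /L_; case: cid2.
have L_le i z : `|z| <= 1 ->
    `|(z - a i) / (1 - (a i)^* * z) - (1 - a i) / (1 - (a i)^* * 1)| <= L_ i * `|1 - z|.
  by rewrite /L_; case: cid2 => /= L _; exact.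
exists (\sum_i L_ i); first exact: sumr_ge0.
move=> z z1; rewrite -mulrBr normrM c1 mul1r mulr_suml.
apply: le_trans (prod_dist_le _ _ _) _ => [i|i|].
- exact: blaschke_factor_le1.
- by rewrite blaschke_factor_at1.
- by apply: ler_sum => i _; exact: L_le.
Qed.

Lemma blaschke_product_le1 N (c : C) (a : 'I_N -> C) z :
  `|c| = 1 -> (forall i, `|a i| < 1) -> `|z| <= 1 ->
  `|c * \prod_(i < N) ((z - a i) / (1 - (a i)^* * z))| <= 1.
Proof.
move=> c1 a1 z1; rewrite normrM c1 mul1r normr_prod prodr_ile1// => i _.
by rewrite normr_ge0 blaschke_factor_le1.
Qed.

Lemma blaschke_product_at1 N (c : C) (a : 'I_N -> C) :
  `|c| = 1 -> (forall i, `|a i| < 1) ->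
  `|c * \prod_(i < N) ((1 - a i) / (1 - (a i)^* * 1))| = 1.
Proof.
move=> c1 a1; rewrite normrM c1 mul1r normr_prod big1// => i _.
exact: blaschke_factor_at1.
Qed.

End BlaschkeEstimates.

(** * Fibres of a finite Blaschke product *)

Section LinearFactors.
Variable F : idomainType.
Implicit Types (u v : F) (I : Type).

(** Factors u + v X with v possibly zero occur in the denominator of a Blaschke
    product (a zero at the origin), so its degree may drop; coefficients are
    therefore tracked instead of degrees. *)
Lemma coef_linear_mul u v (q : {poly F}) k :
  ((u%:P + v *: 'X) * q)`_k.+1 = u * q`_k.+1 + v * q`_k.
Proof. by rewrite mulrDl coefD coefCM -scalerAl coefZ coefXM. Qed.

Lemma size_prod_linear I (s : seq I) (u v : I -> F) :
  (size (\prod_(i <- s) ((u i)%:P + v i *: 'X))%R <= (size s).+1)%N.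
Proof.
elim: s => [|i s IHs]; first by rewrite big_nil size_poly1.
rewrite big_cons; apply/leq_sizeP => -[//|k] sk.
by rewrite coef_linear_mul !nth_default ?mulr0 ?addr0// (leq_trans IHs)// ltnW.
Qed.

Lemma coef_prod_linear I (s : seq I) (u v : I -> F) :
  (\prod_(i <- s) ((u i)%:P + v i *: 'X))`_(size s) = \prod_(i <- s) v i.
Proof.
elim: s => [|i s IHs]; first by rewrite !big_nil coef1.
rewrite !big_cons coef_linear_mul IHs nth_default ?mulr0 ?add0r//.
exact: size_prod_linear.
Qed.

End LinearFactors.

Section BlaschkeFibre.
Variable C : numClosedFieldType.

Lemma exists_pos_le2 (x y : C) : 0 < x -> 0 < y ->
  exists2 z, 0 < z & (z <= x) && (z <= y).
Proof.
move=> x0 y0; have [xy|yx] := real_leP (gtr0_real x0) (gtr0_real y0).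
  by exists x => //; rewrite lexx.
by exists y => //; rewrite lexx ltW.
Qed.

Variables (N : nat) (c : C) (a : 'I_N -> C).
Hypotheses (N_gt0 : (0 < N)%N) (c1 : `|c| = 1) (a1 : forall i, `|a i| < 1).

(* The Blaschke product is P / Q; the fibre over eps is the root set of
   P - eps Q. *)
Let P : {poly C} := c *: \prod_(i < N) ((- a i)%:P + 1 *: 'X).
Let Q : {poly C} := \prod_(i < N) (1%:P + (- (a i)^*) *: 'X).

Let horner_pencil (p q : {poly C}) e z : (p - e *: q).[z] = p.[z] - e * q.[z].
Proof. by rewrite !hornerE. Qed.

Let size_enum_ordI : size (index_enum 'I_N) = N.
Proof. by rewrite /index_enum unlock -enumT size_enum_ord. Qed.

Let hornerP z : P.[z] = c * \prod_i (z - a i).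
Proof.
rewrite hornerZ horner_prod; congr (_ * _); apply: eq_bigr => i _.
by rewrite hornerD hornerZ hornerC hornerX mul1r addrC.
Qed.

Let hornerQ z : Q.[z] = \prod_i (1 - (a i)^* * z).
Proof.
rewrite horner_prod; apply: eq_bigr => i _.
by rewrite hornerD hornerZ hornerC hornerX mulNr.
Qed.

Let sizeP : (size P <= N.+1)%N.
Proof.
rewrite (leq_trans (size_scale_leq _ _))// (leq_trans (size_prod_linear _ _ _))//.
by rewrite size_enum_ordI.
Qed.

Let sizeQ : (size Q <= N.+1)%N.
Proof.
rewrite (leq_trans (size_prod_linear _ _ _))//.
by rewrite size_enum_ordI.
Qed.

Let coefP : P`_N = c.
Proof.
have := coef_prod_linear (index_enum 'I_N) (fun i => - a i) (fun=> 1).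
by rewrite size_enum_ordI coefZ => ->; rewrite big1 ?mulr1.
Qed.

Let coefQ : Q`_N = \prod_i (- (a i)^*).
Proof.
have := coef_prod_linear (index_enum 'I_N) (fun=> 1) (fun i => - (a i)^*).
by rewrite size_enum_ordI.
Qed.

Let c_neq0 : c != 0.
Proof. by rewrite -normr_eq0 c1 oner_eq0. Qed.

Let rootP z : root P z -> exists i, z = a i.
Proof.
rewrite rootE hornerP mulf_eq0 (negPf c_neq0) /= => /prodf_eq0[i _].
by rewrite subr_eq0 => /eqP; exists i.
Qed.

Let Q_neq0 z : `|z| <= 1 -> Q.[z] != 0.
Proof. by move=> z1; rewrite hornerQ; apply/prodf_neq0 => i _; exact: blaschke_den_neq0. Qed.

(** The numerator of the derivative of P / Q: its roots are the critical points of
    the Blaschke product. *)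
Let wronskian := P^`() * Q - P * Q^`().

(** If P' Q = P Q', then P, being coprime to Q, divides P', which is nonzero of
    smaller degree. *)
Let wronskian_neq0 : wronskian != 0.
Proof.
have P'0 : P^`() != 0.
  apply/eqP => /(congr1 (fun p : {poly C} => p`_N.-1)).
  rewrite coef_deriv prednK// coefP coef0 => /eqP.
  by rewrite mulrn_eq0 (negPf c_neq0) orbF eqn0Ngt N_gt0.
apply/eqP => /eqP; rewrite subr_eq0 => /eqP PQ.
have coPQ : coprimep P Q.
  apply/Pdiv.ClosedField.root_coprimep => z /rootP[i ->].
  by apply: Q_neq0; rewrite ltW.
have : (P %| P^`())%R by rewrite -(Gauss_dvdpl _ coPQ) PQ dvdp_mulr.
move=> /(dvdp_leq P'0); rewrite leqNgt lt_size_deriv//.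
by apply/eqP => P0; move: P'0; rewrite P0 linear0 eqxx.
Qed.

(** A multiple root of P - eps Q is a critical point of P / Q, so eps is one of
    finitely many critical values; one of the numbers e / (k + 2) avoids
    them. *)
Lemma exists_simple_value (e : C) : 0 < e ->
  exists2 eps : C, 0 < eps < e & forall z, `|z| <= 1 ->
    root (P - eps *: Q) z -> ~~ root (P^`() - eps *: Q^`()) z.
Proof.
move=> e0; have [rs rsE] := closed_field_poly_normal wronskian.
pose bad := [seq P.[z] / Q.[z] | z <- rs].
pose eps_ k : C := e / k.+2%:R.
have eps_inj : injective eps_.
  move=> i j /(mulfI (lt0r_neq0 e0))/invr_inj/eqP.
  by rewrite eqr_nat => /eqP[].
have [k kbad] : exists k, eps_ k \notin bad.
  apply: contrapT => /forallNP all_bad.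
  have : (size [seq eps_ k | k <- iota 0 (size bad).+1] <= size bad)%N.
    apply: uniq_leq_size; first by rewrite map_inj_uniq ?iota_uniq.
    by move=> _ /mapP[k _ ->]; apply: contrapT => /negP; exact: all_bad.
  by rewrite size_map size_iota ltnn.
exists (eps_ k).
  by rewrite divr_gt0//= ltr_pdivrMr// ltr_pMr// ltr1n.
move=> z z1 Pz; apply: contraNN kbad => P'z.
move: Pz P'z; rewrite !rootE !horner_pencil !subr_eq0 => /eqP Pz /eqP P'z.
have zrs : z \in rs.
  have : root wronskian z.
    rewrite rootE hornerD hornerN !hornerM Pz P'z; apply/eqP.
    by rewrite mulrAC subrr.
  by rewrite rsE rootZ ?lead_coef_eq0// root_prod_XsubC.
by apply/mapP; exists z => //; rewrite Pz mulfK ?Q_neq0.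
Qed.

Let factor_ge i z : 1 <= `|z| -> `|1 - (a i)^* * z| <= `|z - a i|.
Proof.
move=> z1; rewrite -ler_sqr ?nnegrE// -subr_le0 blaschke_factor_identity.
by rewrite mulr_ge0_le0 ?subr_ge0 ?subr_le0 ?expr_le1 ?exprn_ege1// ltW.
Qed.

(** Outside the open disk |Q| <= |P|, so P = eps Q with eps < 1 would force
    P = 0, whose roots are inside. *)
Let root_in_disk (eps : C) z : 0 < eps < 1 -> root (P - eps *: Q) z -> `|z| < 1.
Proof.
move=> /andP[e0 e1]; rewrite rootE horner_pencil subr_eq0 => /eqP PQ.
rewrite real_ltNge ?normr_real ?real1//; apply/negP => z1.
have QP : `|Q.[z]| <= `|P.[z]|.
  rewrite hornerP hornerQ normrM c1 mul1r !normr_prod; apply: ler_prod => i _.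
  by rewrite normr_ge0 factor_ge.
have P0 : P.[z] != 0.
  apply/negP => /rootP[i zE]; move: (a1 i); rewrite -zE => /(le_lt_trans z1).
  by rewrite ltxx.
have := ltxx `|P.[z]|; rewrite {1}PQ normrM (ger0_norm (ltW e0)).
rewrite (le_lt_trans (ler_wpM2l (ltW e0) QP))//.
by rewrite gtr_pMl// normr_gt0.
Qed.

(** The polynomial P - eps Q has degree exactly N, because its coefficient of X^N
    is c, of modulus 1, minus eps times a number of modulus at most 1;
    for a non-critical eps its N roots are distinct. *)
Lemma blaschke_fibre (e : C) : 0 < e -> exists (eps : C) (w : 'I_N -> C),
  [/\ 0 < eps < e, injective w, forall i, `|w i| < 1 &
      forall i, c * \prod_(j < N) ((w i - a j) / (1 - (a j)^* * w i)) = eps].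
Proof.
move=> e0; have [m m0 /andP[m_e m_1]] := exists_pos_le2 e0 ltr01.
have [eps /andP[eps0 eps_m] simple] := exists_simple_value m0.
have eps_e := lt_le_trans eps_m m_e; have eps1 := lt_le_trans eps_m m_1.
have eps01 : 0 < eps < 1 by rewrite eps0.
pose S := P - eps *: Q.
have coefS : S`_N != 0.
  rewrite coefB [(eps *: Q)`_N]coefZ coefP coefQ subr_eq0; apply/eqP => cE.
  have := ltxx (1 : C); rewrite -{1}c1 cE normrM (ger0_norm (ltW eps0)).
  rewrite (le_lt_trans _ eps1)// ler_piMr ?(ltW eps0)// normr_prod prodr_ile1//.
  by move=> i _; rewrite normr_ge0 normrN norm_conjC ltW.
have sizeS : size S = N.+1.
  apply/eqP; rewrite eqn_leq (leq_trans (size_polyD _ _)) /=; last first.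
    by rewrite geq_max sizeP size_polyN (leq_trans (size_scale_leq _ _)).
  by rewrite ltnNge; apply: contra coefS => /leq_sizeP ->.
have [rs rsE] := closed_field_poly_normal S.
have S_lead : lead_coef S != 0 by rewrite lead_coef_eq0 -size_poly_eq0 sizeS.
have size_rs : size rs = N.
  by apply/eqP; rewrite -eqSS -sizeS rsE size_scale// size_prod_XsubC.
have rs_root z : (z \in rs) = root S z.
  by rewrite rsE rootZ// root_prod_XsubC.
have rs_uniq : uniq rs.
  rewrite -separable_prod_XsubC -(eqp_separable (eqp_scale _ S_lead)) -rsE.
  rewrite unlock; apply/Pdiv.ClosedField.root_coprimep => z Sz.
  rewrite derivB [(eps *: Q)^`()]derivZ; apply: simple => //.
  exact: ltW (root_in_disk eps01 Sz).
have rs_w (i : 'I_N) : rs`_i \in rs by rewrite mem_nth// size_rs.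
have w_root (i : 'I_N) : root S rs`_i by rewrite -rs_root.
have w1 (i : 'I_N) : `|rs`_i| < 1 by exact: root_in_disk eps01 (w_root i).
exists eps, (fun i : 'I_N => rs`_i); split; first by rewrite eps0.
- move=> i j /eqP; rewrite nth_uniq ?size_rs// => /eqP; exact: val_inj.
- by [].
- move=> i; have := rs_w i; rewrite rs_root rootE horner_pencil subr_eq0 => /eqP PQ.
  by rewrite prodf_div mulrA -hornerP -hornerQ PQ mulfK ?Q_neq0// ltW.
Qed.

End BlaschkeFibre.

(** * Matrices that multiply by functions on a fibre *)

Section SmallConstants.
Variable C : numClosedFieldType.

(** The threshold is explicit: m = c / (1 + c + A^2) is at most 1, so
    (x A)^2 <= x A^2 <= c. *)
Lemma exists_small_factor (A c : C) : 0 <= A -> 0 < c ->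
  exists2 m : C, 0 < m & forall x, 0 <= x <= m -> (x * A) ^+ 2 <= c.
Proof.
move=> A0 c0; have d0 : 0 < 1 + c + A ^+ 2.
  by rewrite ltr_wpDr ?exprn_ge0// ltr_wpDr// ltW.
exists (c / (1 + c + A ^+ 2)); first by rewrite divr_gt0.
move=> x /andP[x0 xm]; rewrite exprMn.
have x1 : x <= 1.
  rewrite (le_trans xm)// ler_pdivrMr// mul1r -addrA addrCA lerDl.
  by rewrite addr_ge0 ?exprn_ge0.
apply: le_trans (_ : x * A ^+ 2 <= _).
  by rewrite ler_wpM2r ?exprn_ge0// expr2 ler_piMr.
apply: le_trans (_ : c / (1 + c + A ^+ 2) * A ^+ 2 <= _).
  by rewrite ler_wpM2r ?exprn_ge0.
rewrite mulrAC ler_pdivrMr// ler_wpM2l ?(ltW c0)// lerDr.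
by rewrite addr_ge0// ltW.
Qed.

(** Each factor at most doubles the largest coefficient.  This is what makes the
    companion matrices of polynomials with roots in the disk uniformly
    bounded. *)
Lemma coef_prod_XsubC_le (I : Type) (s : seq I) (w : I -> C) k :
  (forall i, `|w i| <= 1) ->
  `|(\prod_(i <- s) ('X - (w i)%:P))`_k| <= 2 ^+ size s.
Proof.
move=> w1; elim: s k => [|i s IHs] k.
  by rewrite big_nil coef1 expr0; case: eqP; rewrite ?normr1 ?normr0.
rewrite big_cons mulrBl coefB coefXM coefCM exprS mulr_natl mulr2n.
rewrite (le_trans (ler_normB _ _))// lerD//.
  by case: k => [|k] /=; [rewrite normr0 exprn_ge0|exact: IHs].
by rewrite normrM (le_trans _ (IHs k))// ler_piMl.
Qed.

End SmallConstants.

(** The rescaling of the monomials: 1 is kept, the higher powers are multiplied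
    by mu. *)
Definition weight_mx (C : numClosedFieldType) n (mu : C) : 'M[C]_n.+2 :=
  diag_mx (\row_i (if i == 0 then 1 else mu)).

Section FibreMatrices.
Variables (C : numClosedFieldType) (n : nat) (w : 'I_n.+2 -> C).
Hypotheses (w_inj : injective w) (w1 : forall i, `|w i| < 1).
Local Notation N := n.+2.

(* Row i of V lists the values of X^i at the points w, so right multiplication
   by V evaluates at w a polynomial given by the row of its coefficients. *)
Let V := Vandermonde N (\row_i w i).

Let V_unit : V \in unitmx.
Proof.
rewrite unitmxE unitfE det_Vandermonde; apply/prodf_neq0 => i _.
apply/prodf_neq0 => j ij; rewrite !mxE subr_eq0; apply: contraTneq ij.
by move=> /w_inj ->; rewrite ltnn.
Qed.

(** On coefficient rows of polynomials p of degree less than N, this sends p to the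
    interpolation polynomial of g p at the points w. *)
Definition poly_calculus (g : 'I_N -> C) : 'M[C]_N :=
  V *m diag_mx (\row_i g i) *m invmx V.

Lemma poly_calculusM g h :
  poly_calculus (fun i => g i * h i) = poly_calculus g *m poly_calculus h.
Proof.
rewrite /poly_calculus !mulmxA mulmxKV//; congr (_ *m _).
rewrite -mulmxA mulmx_diag; congr (_ *m diag_mx _).
by apply/rowP => i; rewrite !mxE.
Qed.

Lemma poly_calculusX j : poly_calculus (fun i => w i ^+ j) = poly_calculus w ^+ j.
Proof.
elim: j => [|j IHj].
  rewrite expr0 /poly_calculus (_ : diag_mx _ = 1%:M) ?mulmx1 ?mulmxV//.
  by apply/matrixP => i k; rewrite !mxE expr0.
rewrite exprS -IHj -[RHS]poly_calculusM; congr poly_calculus.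
by apply/funext => i; rewrite exprS.
Qed.

Lemma poly_calculus_linear u v g h :
  poly_calculus (fun i => u * g i + v * h i) =
  u *: poly_calculus g + v *: poly_calculus h.
Proof.
rewrite /poly_calculus.
have -> : diag_mx (\row_i (u * g i + v * h i)) =
    u *: diag_mx (\row_i g i) + v *: diag_mx (\row_i h i).
  apply/matrixP => i k; rewrite !mxE.
  by case: eqP; rewrite ?mulr0n ?mulr0 ?addr0.
by rewrite mulmxDr mulmxDl -!scalemxAr -!scalemxAl.
Qed.

(** Row i is the interpolation polynomial of X^i g: it is recognized by its
    values. *)
Lemma row_poly_calculus (q : 'rV[C]_N) (i : 'I_N) g :
  (forall k, w k ^+ i * g k = (q *m V) 0 k) -> row i (poly_calculus g) = q.
Proof.
move=> wg; rewrite /poly_calculus !row_mul.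
suff -> : row i V *m diag_mx (\row_i g i) = q *m V by rewrite mulmxK.
by apply/rowP => k; rewrite -wg mul_mx_diag !mxE.
Qed.

Lemma row0_poly_calculusX (j : 'I_N) :
  row 0 (poly_calculus (fun i => w i ^+ j)) = delta_mx 0 j.
Proof. by apply: row_poly_calculus => k; rewrite -rowE !mxE expr0 mul1r. Qed.

(** For g the identity this is a companion matrix: X^i goes to X^(i+1), except that
    X^N is reduced modulo the product of the X - w_i, whose coefficients are
    bounded independently of the points. *)
Lemma poly_calculus_entry i j : `|poly_calculus w i j| <= 2 ^+ N.
Proof.
have -> : poly_calculus w i j = row i (poly_calculus w) 0 j by rewrite [RHS]mxE.
have pow_ge1 : 1 <= 2 ^+ N :> C by apply: exprn_ege1; rewrite (ler_nat C 1 2).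
have [iN|iN] := ltnP i.+1 N.
  rewrite (@row_poly_calculus (delta_mx 0 (Ordinal iN))) => [|k].
    rewrite mxE; apply: le_trans pow_ge1.
    by case: (_ && _); rewrite ?normr1 ?normr0.
  by rewrite -rowE !mxE exprSr.
pose p := \prod_(i < N) ('X - (w i)%:P).
have size_p : size p = N.+1 by rewrite size_prod_XsubC /index_enum unlock -enumT size_enum_ord.
have -> : row i (poly_calculus w) = \row_j - p`_j.
  apply: row_poly_calculus => k.
  have : p.[w k] = 0.
    by apply/eqP; rewrite horner_prod; apply/prodf_eq0; exists k; rewrite // !hornerE subrr.
  have pN : p`_N = 1.
    have /monicP : p \is monic by exact: monic_prod_XsubC.
    by rewrite lead_coefE size_p.
  rewrite horner_coef size_p big_ord_recr /= pN mul1r => /eqP.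
  rewrite addrC addr_eq0 => /eqP wN.
  have iE : i = n.+1 :> nat by apply/eqP; rewrite eqn_leq -ltnS ltn_ord -ltnS.
  rewrite -exprSr iE wN mxE -sumrN; apply: eq_bigr => j' _.
  by rewrite !mxE mulNr.
rewrite mxE normrN (le_trans (coef_prod_XsubC_le _ _ _))//.
  by move=> k; exact: ltW.
by rewrite /index_enum unlock -enumT size_enum_ord.
Qed.

Variables (tau mu eps : C).
Hypotheses (mu_neq0 : mu != 0) (eps_neq0 : eps != 0).

(* The functional tau p(1), as a column acting on coefficient rows. *)
Let l : 'cV[C]_N := const_mx tau.
Let W : 'M[C]_N := weight_mx n mu.

(** For j < N, the polynomial X^j needs no reduction, and its value at 1 is 1. *)
Lemma poly_calculusX_const (j : 'I_N) :
  (poly_calculus (fun i => w i ^+ j) *m l) 0 0 = tau.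
Proof.
set M := poly_calculus _.
have -> : (M *m l) 0 0 = (row 0 M *m l) 0 0 by rewrite -row_mul [RHS]mxE.
by rewrite row0_poly_calculusX -rowE !mxE.
Qed.

Let W_unit : W \in unitmx.
Proof.
rewrite unitmxE unitfE det_diag; apply/prodf_neq0 => i _; rewrite mxE.
by case: ifP => _ //; rewrite oner_eq0.
Qed.

(** Rows are vectors of the new basis given by their values at the points: the
    first point is a zero of the Blaschke product, the others are the fibre w.
    The lower left block is such that, when f vanishes at the first point and
    equals eps g on the fibre, the corner entry of the conjugate matrix is l(g),
    with no factor eps. *)
Definition fibre_basis : 'M[C]_(1 + N) :=
  block_mx 1%:M 0 (- eps^-1 *: (W *m l)) (W *m V).

Let fibre_basis_inv : 'M[C]_(1 + N) :=
  block_mx 1%:M 0 (eps^-1 *: (invmx V *m l)) (invmx V *m invmx W).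

Let fibre_basisK : fibre_basis *m fibre_basis_inv = 1%:M.
Proof.
rewrite mulmx_block !mulmx1 !mul1mx !mul0mx !mulmx0 ?addr0 add0r.
rewrite -scalemxAr !mulmxA (mulmxK V_unit) mulmxV// -scalerDl addNr scale0r.
by rewrite -scalar_mx_block.
Qed.

Lemma fibre_basis_unit : fibre_basis \in unitmx.
Proof. by have [] := mulmx1_unit fibre_basisK. Qed.

Lemma fibre_basis_conj g :
  fibre_basis *m diag_mx (row_mx 0 (eps *: \row_i g i)) *m invmx fibre_basis =
  block_mx 0 0 (W *m (poly_calculus g *m l))
    (eps *: (W *m poly_calculus g *m invmx W)).
Proof.
have -> : invmx fibre_basis = fibre_basis_inv.
  by rewrite -[RHS]mul1mx -(mulVmx fibre_basis_unit) -mulmxA fibre_basisK mulmx1.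
rewrite diag_mx_row !mulmx_block !(linear0, mul0mx, addr0, add0r).
rewrite [diag_mx (eps *: _)]linearZ /= -!scalemxAr -!scalemxAl scalerA mulVf// scale1r.
by rewrite /poly_calculus !mulmxA.
Qed.

(** The three summands bound the value tau of the functional on X^j, the rest of
    its block (small with mu), and the square block (small with eps). *)
Lemma fnorm_fibre_basis_conj (j : 'I_N) (G d : C) :
  1 <= G -> fnorm (poly_calculus w) <= G -> 0 <= mu -> 0 <= eps ->
  (mu * (G ^+ N * fnorm l)) ^+ 2 <= d ->
  (eps * (fnorm W * G ^+ N * fnorm (invmx W))) ^+ 2 <= d ->
  fnorm (fibre_basis *m diag_mx (row_mx 0 (eps *: \row_i w i ^+ j)) *m
    invmx fibre_basis) ^+ 2 <= `|tau| ^+ 2 + d + d.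
Proof.
move=> G1 MG mu0 eps0 d1 d2; rewrite fibre_basis_conj fnorm_lower_rows.
set M := poly_calculus _.
have G0 : 0 <= G by apply: le_trans G1.
have ME : M = poly_calculus w ^+ j by rewrite /M poly_calculusX.
(* For j = 0 the matrix is the identity, of Frobenius norm larger than 1: the
   norm of M is never used by itself. *)
have fM p (Y : 'M[C]_(N, p)) : fnorm (M *m Y) <= G ^+ N * fnorm Y.
  rewrite ME; case: (val j) (ltn_ord j) => [|k] kN.
    by rewrite expr0 mul1mx ler_peMl ?fnorm_ge0// exprn_ege1.
  rewrite (le_trans (fnormM _ _))// ler_wpM2r ?fnorm_ge0//.
  rewrite (le_trans (fnorm_expr _ _))//.
  apply: le_trans (_ : G ^+ k.+1 <= _); first by rewrite lerXn2r ?nnegrE ?fnorm_ge0.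
  by rewrite ler_weXn2l// ltnW.
have GN0 : 0 <= G ^+ N by exact: exprn_ge0.
(* As N is a successor, simplification would unfold this power into a
   product. *)
move: (G ^+ N) GN0 fM d1 d2 => GN GN0 fM d1 d2.
have Ml0 : (M *m l) 0 0 = tau by exact: poly_calculusX_const.
apply: lerD; last first.
  apply: le_trans d2; rewrite lerXn2r ?nnegrE ?fnorm_ge0//.
    by rewrite !mulr_ge0 ?fnorm_ge0.
  rewrite fnormZ (ger0_norm eps0) ler_wpM2l// -mulmxA -mulrA.
  by rewrite (le_trans (fnormM _ _))// ler_wpM2l ?fnorm_ge0.
apply: le_trans (_ : `|tau| ^+ 2 + (mu * fnorm (M *m l)) ^+ 2 <= _); last first.
  rewrite lerD2l; apply: le_trans d1; rewrite lerXn2r ?nnegrE ?ler_wpM2l//.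
    by rewrite mulr_ge0 ?fnorm_ge0.
  by rewrite !mulr_ge0 ?fnorm_ge0.
have WE i : (W *m (M *m l)) i 0 = (if i == 0 then 1 else mu) * (M *m l) i 0.
  by rewrite mul_diag_mx [LHS]mxE mxE.
rewrite exprMn !fnorm_col_sqr (bigD1 0)//= WE eqxx mul1r Ml0 lerD2l.
rewrite mulr_sumr [X in _ <= X](bigD1 0)//= ler_wpDl ?mulr_ge0 ?exprn_ge0//.
apply: ler_sum => i i0.
by rewrite WE (negPf i0) normrM exprMn (ger0_norm mu0).
Qed.

(** An affine function has degree 1 < N, so it needs no reduction and the functional
    takes its value at 1. *)
Lemma fibre_basis_conj_test u v :
  (fibre_basis *m diag_mx (row_mx 0 (eps *: \row_i (u + v * w i))) *m
    invmx fibre_basis) (rshift 1 0) (lshift N 0) = tau * (u + v).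
Proof.
rewrite fibre_basis_conj block_mxEdl mul_diag_mx [LHS]mxE mxE eqxx mul1r.
have -> : poly_calculus (fun i => u + v * w i) =
    u *: poly_calculus (fun i => w i ^+ @ord0 n.+1) +
    v *: poly_calculus (fun i => w i ^+ @Ordinal N 1 isT).
  by rewrite -poly_calculus_linear; congr poly_calculus; apply/funext => i;
    rewrite expr0 mulr1 expr1.
rewrite mulmxDl -!scalemxAl mxE [X in X + _]mxE [X in _ + X]mxE.
by rewrite !poly_calculusX_const -mulrDl mulrC.
Qed.

End FibreMatrices.

(** The constants are chosen in the order mu, eps: the bound on the row block does
    not involve eps, while the square block is conjugated by the weights and
    needs eps small depending on mu. *)
Lemma exists_fibre_matrices (C : numClosedFieldType) (n : nat) (c : C)
    (a : 'I_n.+2 -> C) (tau e : C) :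
  `|c| = 1 -> (forall i, `|a i| < 1) -> 0 < tau < 1 -> 0 < e ->
  exists (eps : C) (w : 'I_n.+2 -> C) (S : 'M[C]_(1 + n.+2)),
  [/\ 0 < eps < e, (forall i, `|w i| < 1) /\
      (forall i, c * \prod_(j < n.+2) ((w i - a j) / (1 - (a j)^* * w i)) = eps),
      S \in unitmx,
      forall j : 'I_n.+2, fnorm (S *m
        diag_mx (row_mx 0 (eps *: \row_i w i ^+ j)) *m invmx S) <= 1 &
      forall u v, (S *m diag_mx (row_mx 0 (eps *: \row_i (u + v * w i))) *m
        invmx S) (rshift 1 0) (lshift n.+2 0) = tau * (u + v)].
Proof.
move=> c1 a1 /andP[tau0 tau1] e0; pose N := n.+2.
pose G : C := N%:R * 2 ^+ N.
have G1 : 1 <= G.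
  have p1 : 1 <= 2 ^+ N :> C by apply: exprn_ege1; rewrite (ler_nat C 1 2).
  by rewrite -[1]mulr1 ler_pM// ?ler1n.
have G0 : 0 <= G by apply: le_trans G1.
have GN0 : 0 <= G ^+ N by exact: exprn_ge0.
(* Half of the room that tau leaves below 1, for each of the two
   perturbations. *)
pose d := (1 - tau ^+ 2) / 2.
have d0 : 0 < d.
  by rewrite divr_gt0// subr_gt0 expr_lt1// ltW.
have [|mu mu0 mu_small] := @exists_small_factor C
    (G ^+ N * fnorm (const_mx tau : 'cV[C]_N)) d _ d0.
  by rewrite mulr_ge0 ?fnorm_ge0.
pose W := weight_mx n mu.
have [|m m0 eps_small] := @exists_small_factor C
    (fnorm W * G ^+ N * fnorm (invmx W)) d _ d0.
  exact: mulr_ge0 (mulr_ge0 (fnorm_ge0 _) GN0) (fnorm_ge0 _).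
have [m' m'0 /andP[m'e m'm]] := exists_pos_le2 e0 m0.
have [eps [w [/andP[eps0 epsm'] w_inj w1 wE]]] := @blaschke_fibre C N c a isT c1 a1 m' m'0.
have [mu_neq0 eps_neq0] := (lt0r_neq0 mu0, lt0r_neq0 eps0).
exists eps, w, (fibre_basis w tau mu eps); split=> //.
- by rewrite eps0 (lt_le_trans epsm').
- exact: fibre_basis_unit.
- move=> j; rewrite -ler_sqr ?nnegrE ?fnorm_ge0// expr1n.
  have -> : 1 = `|tau| ^+ 2 + d + d.
    by rewrite (gtr0_norm tau0) -addrA -splitr addrC subrK.
  apply: (@fnorm_fibre_basis_conj C n w w_inj tau mu eps mu_neq0 eps_neq0 j G) => //.
  + by apply: fnorm_le_entries; [rewrite exprn_ge0|exact: poly_calculus_entry].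
  + exact: ltW.
  + exact: ltW.
  + by apply: mu_small; rewrite ltW/=.
  + by apply: eps_small; rewrite ltW//= (le_trans (ltW epsm')).
- by move=> u v; exact: fibre_basis_conj_test.
Qed.

(** * The disk algebra and its subalgebras *)

Section DiskAlgebraTheory.
Variable R : realType.
Implicit Types (f g B : R[i] -> R[i]).

Lemma complex_Re_continuous : continuous (@complex.Re R).
Proof.
move=> z; have Fz : Filter (nbhs z) by exact: nbhs_filter.
apply/(@cvgrPdist_lt _ R _ (nbhs z)) => e e0; apply/nbhs_ballP; exists e%:C%C => /=.
  by rewrite ltcR.
by move=> w; rewrite -ball_normE /= -raddfB -ltcR => /(le_lt_trans (normc_ge_Re _)).
Qed.

Lemma complex_pair_continuous : continuous (fun p : R * R => (p.1 +i* p.2)%C).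
Proof.
move=> p; have Fp : Filter (nbhs p) by exact: nbhs_filter.
apply/(@cvgrPdist_lt _ R[i] _ (nbhs p)) => _ /gt0_real_complex[e e0 ->].
have e20 : 0 < e / 2 by rewrite divr_gt0.
case: p {Fp} => a b; apply/nbhs_ballP; exists (e / 2) => //= -[x y] [/=].
rewrite -!ball_normE /= => ax ay.
apply: le_lt_trans (normc_le_ReIm _) _.
by rewrite ltcR [e]splitr ltrD.
Qed.

Lemma rnorm_continuous (V : normedModType R[i]) : continuous (@rnorm R V).
Proof.
move=> x; apply: (@continuous_comp V R[i] R Num.norm (@complex.Re R)).
  exact: norm_continuous.
exact: complex_Re_continuous.
Qed.

Lemma closed_disk_compact : compact (@closed_disk R).
Proof.
apply: (subclosed_compact (B := [set (p.1 +i* p.2)%C |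
    p in (`[-1, 1] : set R) `*` (`[-1, 1] : set R)])).
- rewrite (_ : @closed_disk R = [set z | rnorm z <= 1]); last first.
    by apply/seteqP; split=> z /=; rewrite /closed_disk /= -rnormE lecR.
  apply: closed_comp (@closed_le R 1) => z _.
  exact: rnorm_continuous.
- apply: continuous_compact.
    by apply: continuous_subspaceT => p; exact: complex_pair_continuous.
  by apply: compact_setX; exact: segment_compact.
- move=> z; rewrite /closed_disk /= => z1; exists (complex.Re z, complex.Im z) => /=.
    by split=> /=; rewrite in_itv /= -ler_norml -lecR (le_trans _ z1)//;
       [exact: normc_ge_Re|exact: normc_ge_Im].
  by case: z {z1}.
Qed.

(** The supremum norm is informative only for bounded functions; boundedness comes
    from compactness of the closed disk. *)
Lemma disk_algebra_bounded f : disk_algebra f ->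
  exists M : R, forall z, closed_disk z -> rnorm (f z) <= M.
Proof.
move=> [cf _].
have /compact_bounded [M [Mr fM]] : compact [set rnorm (f z) | z in @closed_disk R].
  apply: continuous_compact closed_disk_compact => z.
  apply: (@continuous_comp (subspace (@closed_disk R)) R[i] R f (@rnorm R R[i])).
    exact: cf.
  exact: rnorm_continuous.
exists (M + 1) => z z1; have := fM (M + 1) _ (rnorm (f z)).
rewrite ltrDl ltr01 => /(_ isT)/= H.
apply: le_trans (H _); last by exists z.
exact: ler_norm.
Qed.

Lemma disk_algebra_cst c : disk_algebra (cst c : R[i] -> R[i]).
Proof. by split=> [z|z _]; [exact: cvg_cst|exact: derivable_cst]. Qed.

Lemma disk_algebra_id : disk_algebra (@id R[i]).
Proof.
split=> [|z _]; last exact: derivable_id.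
by apply: continuous_subspaceT => z; exact: cvg_id.
Qed.

Lemma disk_algebraD f g : disk_algebra f -> disk_algebra g ->
  disk_algebra (fun z => f z + g z).
Proof.
move=> [cf df] [cg dg]; split=> [z|z z1]; first by apply: cvgD; [exact: cf|exact: cg].
by apply: derivableD; [exact: df|exact: dg].
Qed.

Lemma disk_algebraM f g : disk_algebra f -> disk_algebra g ->
  disk_algebra (fun z => f z * g z).
Proof.
move=> [cf df] [cg dg]; split=> [z|z z1]; first by apply: cvgM; [exact: cf|exact: cg].
by apply: derivableM; [exact: df|exact: dg].
Qed.

Lemma disk_algebraV f : disk_algebra f -> (forall z, closed_disk z -> f z != 0) ->
  disk_algebra (fun z => (f z)^-1).
Proof.
move=> [cf df] f0; split=> [|z z1]; last first.
  apply: derivableV; last exact: df.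
  by apply: f0; rewrite /closed_disk /= ltW.
apply/subspace_continuousP => z z1.
apply: cvgV; first exact: f0.
by move/subspace_continuousP : cf; exact.
Qed.

Lemma disk_algebra_prod n (F : 'I_n -> R[i] -> R[i]) :
  (forall i, disk_algebra (F i)) -> disk_algebra (fun z => \prod_i F i z).
Proof.
move=> dF; elim: (index_enum _) => [|i s IHs].
  rewrite (_ : (fun z => _) = cst 1); first exact: disk_algebra_cst.
  by apply/funext => z; rewrite big_nil.
rewrite (_ : (fun z => _) = (fun z => F i z * \prod_(j <- s) F j z)).
  exact: (disk_algebraM (dF i) IHs).
by apply/funext => z; rewrite big_cons.
Qed.

Lemma disk_algebra_blaschke N (c : R[i]) (a : 'I_N -> R[i]) :
  (forall i, open_disk (a i)) -> disk_algebra (blaschke c a).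
Proof.
move=> a1; apply: disk_algebraM; first exact: disk_algebra_cst.
apply: disk_algebra_prod => i; apply: disk_algebraM.
  by apply: disk_algebraD; [exact: disk_algebra_id|exact: disk_algebra_cst].
apply: disk_algebraV => [|z z1]; last exact: (blaschke_den_neq0 (a1 i) z1).
rewrite (_ : (fun z => _) = (fun z => cst 1 z + cst (- (a i)^*) z * id z)).
  apply: disk_algebraD; first exact: disk_algebra_cst.
  exact: (disk_algebraM (disk_algebra_cst _) disk_algebra_id).
by apply/funext => z /=; rewrite mulNr.
Qed.

Lemma sup_norm_has_sup f (M : R) : (forall z, closed_disk z -> rnorm (f z) <= M) ->
  has_sup [set rnorm (f z) | z in @closed_disk R].
Proof.
move=> fM; split; last by exists M => _ [z z1 <-]; exact: fM.
by exists (rnorm (f 0)), 0 => //; rewrite /closed_disk /= normr0.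
Qed.

Lemma sup_norm_le f (M : R) : (forall z, closed_disk z -> rnorm (f z) <= M) ->
  sup_norm f <= M.
Proof.
move=> fM; apply: ge_sup; first by have [] := sup_norm_has_sup fM.
by move=> _ [z z1 <-]; exact: fM.
Qed.

Section AlgB.
Variables (N : nat) (B : R[i] -> R[i]).
Hypothesis B_blaschke : is_blaschke N B.

Lemma algB_bounded f : algB B f ->
  exists M : R, forall z, closed_disk z -> rnorm (f z) <= M.
Proof.
case: B_blaschke => c [a [_ a1 BE]] [k [g [dg fE]]].
have : disk_algebra (fun z => cst k z + blaschke c a z * g z).
  apply: disk_algebraD; first exact: disk_algebra_cst.
  exact: (disk_algebraM (disk_algebra_blaschke c a1) dg).
move=> /disk_algebra_bounded[M fM]; exists M => z z1.
by rewrite fE// BE//; exact: fM.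
Qed.

Lemma le_sup_norm f z : algB B f -> closed_disk z -> rnorm (f z) <= sup_norm f.
Proof.
move=> /algB_bounded[M fM] z1; apply: sup_upper_bound; first exact: sup_norm_has_sup fM.
by exists z.
Qed.

(** In (k1 + B g1) (k2 + B g2), the term B (B g1 g2) is in the ideal because B
    agrees on the closed disk with a Blaschke product, which belongs to the disk
    algebra. *)
Lemma algB_closed_unital : closed_unital_subalgebra (algB B) (algB B).
Proof.
case: B_blaschke => c [a [_ a1 BE]]; split=> //.
- by exists 1, (cst 0); split=> [|z _]; [exact: disk_algebra_cst|rewrite mulr0 addr0].
- move=> k f1 f2 [k1 [g1 [d1 f1E]]] [k2 [g2 [d2 f2E]]].
  exists (k * k1 + k2), (fun z => k * g1 z + g2 z); split.
    exact: (disk_algebraD (disk_algebraM (disk_algebra_cst k) d1) d2).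
  move=> z z1 /=; rewrite f1E// f2E// -[k *: _]/(k * _); ring.
- move=> f1 f2 [k1 [g1 [d1 f1E]]] [k2 [g2 [d2 f2E]]].
  exists (k1 * k2), (fun z => k1 * g2 z + (k2 * g1 z + blaschke c a z * (g1 z * g2 z))).
  split.
    have dcst k := disk_algebra_cst k.
    apply: disk_algebraD; first exact: (disk_algebraM (dcst k1) d2).
    apply: disk_algebraD; first exact: (disk_algebraM (dcst k2) d1).
    exact: (disk_algebraM (disk_algebra_blaschke c a1) (disk_algebraM d1 d2)).
  move=> z z1 /=; rewrite f1E// f2E// -BE//.
  ring.
Qed.

(** The intersection defining the generated subalgebra contains A_B itself among
    its terms. *)
Lemma algB0_sub : algB0 B `<=` algB B.
Proof.
apply: smallest_sub; first exact: algB_closed_unital.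
have B_in : algB B B.
  exists 0, (cst 1); split=> [|z _]; first exact: disk_algebra_cst.
  by rewrite add0r mulr1.
move=> _ [->//|->].
by exists 0, id; split=> [|z _]; [exact: disk_algebra_id|rewrite add0r mulrC].
Qed.

Lemma algB0_generator_gen : (2 <= N)%N -> algB0_generators B `<=` algB_generators N B.
Proof.
move=> N2 _ [->|->]; [exists 0%N|exists 1%N] => //=; first exact: ltnW.
by apply/funext => z; rewrite expr0 mul1r.
Qed.

End AlgB.
End DiskAlgebraTheory.

(** * Representations by diagonalizable matrices *)

Section NodeRepresentation.
Variables (R : realType) (n : nat) (z : 'I_n -> R[i]) (S : 'M[R[i]]_n).
Hypotheses (z1 : forall i, closed_disk (z i)) (S_unit : S \in unitmx).
Variable A : set (R[i] -> R[i]).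
Hypothesis A_bounded : forall f, A f ->
  forall w, closed_disk w -> rnorm (f w) <= sup_norm f.

(** The diagonal matrix of the values of f, in the basis given by the rows
    of S. *)
Definition node_matrix (f : R[i] -> R[i]) : 'M[R[i]]_n :=
  S *m diag_mx (\row_i f (z i)) *m invmx S.

Definition node_rep (f : R[i] -> R[i]) : euclid_hilbert R n -> euclid_hilbert R n :=
  @row_action R n (node_matrix f).

Lemma fnorm_node_matrix f (M : R) : 0 <= M ->
  (forall w, closed_disk w -> rnorm (f w) <= M) ->
  fnorm (node_matrix f) <= fnorm S * (n%:R * M%:C%C) * fnorm (invmx S).
Proof.
move=> M0 fM; rewrite (le_trans (fnormM _ _))// ler_wpM2r ?fnorm_ge0//.
rewrite (le_trans (fnormM _ _))// ler_wpM2l ?fnorm_ge0//.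
apply: fnorm_le_entries => [|i j]; first by rewrite ler0c.
rewrite !mxE; case: eqP => _; last by rewrite mulr0n normr0 ler0c.
by rewrite mulr1n -rnormE lecR fM.
Qed.

(** Conjugation of diagonal matrices is multiplicative, and diagonal entries are
    values, hence bounded by the supremum norm. *)
Lemma node_rep_unital : unital_representation A node_rep.
Proof.
split.
- by move=> f _; exact: row_action_bounded.
- move=> f g _ _ fg; rewrite /node_rep /node_matrix.
  by congr (row_action (_ *m diag_mx _ *m _)); apply/rowP => i; rewrite !mxE fg.
- move=> x; rewrite /node_rep /node_matrix (_ : diag_mx _ = 1%:M).
    by rewrite /row_action mulmx1 mulmxV// mulmx1.
  by apply/matrixP => i j; rewrite !mxE.
- move=> k f g _ _ x; rewrite /node_rep /row_action.
  rewrite (_ : node_matrix _ = k *: node_matrix f + node_matrix g).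
    by rewrite mulmxDr -scalemxAr.
  rewrite /node_matrix (_ : diag_mx _ =
      k *: diag_mx (\row_i f (z i)) + diag_mx (\row_i g (z i))).
    by rewrite mulmxDr mulmxDl -scalemxAr -scalemxAl.
  by apply/matrixP => i j; rewrite !mxE mulrnAr -mulrnDl.
- move=> f g _ _ x; rewrite /node_rep /row_action -mulmxA; congr (_ *m _).
  rewrite /node_matrix !mulmxA mulmxKV//; congr (_ *m _).
  rewrite -mulmxA mulmx_diag; congr (_ *m diag_mx _).
  by apply/rowP => i; rewrite !mxE mulrC.
- exists (complex.Re (fnorm S * fnorm (invmx S)) * n%:R) => f Af.
  have f0 : 0 <= sup_norm f.
    apply: le_trans (A_bounded Af (w := 0) _); last by rewrite /closed_disk /= normr0.
    by rewrite -lecR rnormE; exact: normr_ge0.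
  apply: op_norm_row_action_le; rewrite (le_trans (fnorm_node_matrix f0 (A_bounded Af)))//.
  rewrite !rmorphM /= rmorph_nat RRe_real; last first.
    by rewrite ger0_real// mulr_ge0 ?fnorm_ge0.
  by rewrite le_eqVlt; apply/orP; left; apply/eqP; ring.
Qed.

End NodeRepresentation.


(** * The test function *)

Section TestFunction.
Variables (R : realType) (N : nat) (B : R[i] -> R[i]).
Hypothesis B_blaschke : is_blaschke N B.

(** Its interpolation polynomial at the zeros of B takes the value 1 + t^2 at 1,
    while its modulus on the disk is at most 1 + t^2 / 2 for a suitable t. *)
Definition test_factor (t : R) (z : R[i]) : R[i] :=
  (1 + z) / 2 - (t ^+ 2)%:C%C * (B 1)^* * (B z - B 1).

Lemma one_in_closed_disk : closed_disk (1 : R[i]).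
Proof. by rewrite /closed_disk /= normr1. Qed.

Lemma blaschke_norm1 : `|B 1| = 1.
Proof.
case: B_blaschke => c [a [c1 a1 BE]].
by rewrite BE; [exact: blaschke_product_at1|exact: one_in_closed_disk].
Qed.

Lemma blaschke_le1 z : closed_disk z -> `|B z| <= 1.
Proof.
case: B_blaschke => c [a [c1 a1 BE]] z1.
by rewrite BE//; exact: blaschke_product_le1.
Qed.

(** With p = |1 + z| / 2 and q = |1 - z| / 2, the modulus is at most p + t q for a
    Lipschitz constant 1 / t, and p^2 + q^2 <= 1 by the parallelogram identity;
    then p <= (1 + p^2) / 2 and t q <= (t^2 + q^2) / 2. *)
Lemma test_factor_bound : exists2 t : R, 0 < t <= 1 &
  forall z, closed_disk z -> `|test_factor t z| <= (1 + t ^+ 2 / 2)%:C%C.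
Proof.
have [L [L0 BL]] : exists L : R, 0 <= L /\ forall z, closed_disk z ->
    `|B z - B 1| <= L%:C%C * `|1 - z|.
  case: B_blaschke => c [a [c1 a1 BE]].
  have [L L0 HL] := blaschke_product_lipschitz c1 a1.
  have LE : (complex.Re L)%:C%C = L by rewrite RRe_real ?ger0_real.
  exists (complex.Re L); split; first by rewrite -ler0c LE.
  by move=> z z1; rewrite LE !BE//; [exact: HL|exact: one_in_closed_disk].
(* The factor 2 compensates for the half in q, and adding 1 gives K >= 1, hence
   t <= 1. *)
pose K := 2 * L + 1; have K0 : 0 < K by rewrite ltr_wpDl// mulr_ge0.
have tK : K^-1 * K = 1 by rewrite mulVf// gt_eqF.
have t0 : 0 < K^-1 by rewrite invr_gt0.
exists K^-1; first by rewrite t0 invf_le1// lerDr mulr_ge0.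
move: (K^-1) t0 tK => t t0 tK z z1.
pose p := rnorm (1 + z) / 2; pose q := rnorm (1 - z) / 2.
have q0 : 0 <= q by rewrite divr_ge0// -lecR rnormE; exact: normr_ge0.
have pq : p ^+ 2 + q ^+ 2 <= 1.
  rewrite -lecR rmorphD /= !rmorphXn !rmorphM /= !rnormE !fmorphV !rmorph_nat /=.
  rewrite !exprMn -mulrDl.
  have -> : `|1 + z| ^+ 2 + `|1 - z| ^+ 2 = 2 * (1 + `|z| ^+ 2).
    by rewrite !normCK !(rmorphD, rmorphN, rmorph1) /=; ring.
  rewrite (_ : _ * _ * _ = (1 + `|z| ^+ 2) / 2); last by field.
  rewrite ler_pdivrMr// mul1r (_ : 2 = 1 + 1)// lerD2l expr_le1//.
apply: le_trans (ler_normB _ _) _.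
apply: le_trans (_ : (p + t ^+ 2 * (L * (q * 2)))%:C%C <= _).
  rewrite rmorphD /= lerD//.
    by rewrite normrM normfV normr_nat rmorphM /= rnormE fmorphV rmorph_nat.
  rewrite !normrM norm_conjC blaschke_norm1 mulr1 ger0_norm ?ler0c ?sqr_ge0//.
  rewrite [X in _ <= X]rmorphM /= ler_wpM2l ?ler0c ?sqr_ge0//.
  by rewrite (le_trans (BL _ z1))// divfK// rmorphM /= rnormE.
rewrite lecR.
have step : t ^+ 2 * (L * (q * 2)) <= t * q.
  rewrite (_ : t * q = t ^+ 2 * (K * q)); last first.
    by rewrite -[LHS]mulr1 -tK; ring.
  by rewrite ler_wpM2l ?sqr_ge0// /K; nra.
have := sqr_ge0 (1 - p); have := sqr_ge0 (t - q); nra.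
Qed.

(** The function is (h B(1) + 1/2) B + (1/2) zB - h B^2. *)
Lemma test_function_algB0 t : algB0 B (fun z => B z * test_factor t z).
Proof.
move=> S [S_alg S_gen].
have BS : S B by apply: S_gen; left.
have zBS : S (fun z => z * B z) by apply: S_gen; right.
set h := (t ^+ 2)%:C%C * (B 1)^*.
have -> : (fun z => B z * test_factor t z) = - h \*: (B \* B) \+
    (2^-1 \*: (fun z => z * B z) \+ ((h * B 1 - 2^-1) \*: B \+ B)).
  apply/funext => z /=; rewrite /test_factor -/h -![_ *: _]/(_ * _).
  by field.
exact: (subalg_linear S_alg (- h) (subalg_mul S_alg BS BS)
  (subalg_linear S_alg 2^-1 zBS (subalg_linear S_alg (h * B 1 - 2^-1) BS BS))).
Qed.

End TestFunction.

Lemma fnorm_delta_le1 (C : numClosedFieldType) n (j : 'I_n) :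
  fnorm (delta_mx 0 j : 'rV[C]_n) <= 1.
Proof.
rewrite (le_trans (fnorm_le_sum _))// (bigD1 j)//= big1 => [|i ij].
  by rewrite mxE !eqxx normr1 addr0.
by rewrite mxE (negPf ij) normr0.
Qed.

(** The factor (1 + d / 8)^-1 is the constant tau of the perturbed functional, and
    e is the point over which the fibre lies. *)
Lemma gap_inequality (R : realFieldType) (d e : R) : 0 < d <= 1 -> e < 4^-1 ->
  1 + d / 2 < (1 + d / 8)^-1 * (1 + d - d * e).
Proof.
move=> /andP[d0 d1] e4; have s0 : 0 < 1 + d / 8 by rewrite addr_gt0 ?divr_gt0.
rewrite ltr_pdivlMl//.
have de : d * e < d * 4^-1 by rewrite ltr_pM2l.
have dd : d * d <= d * 1 by rewrite ler_wpM2l ?(ltW d0).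
nra.
Qed.

(** * Non-contractive representations *)

Lemma exists_noncontractive_nodes (R : realType) (N : nat) (B : R[i] -> R[i]) :
  (2 <= N)%N -> is_blaschke N B ->
  exists (n : nat) (z : 'I_n -> R[i]) (S : 'M[R[i]]_n),
  [/\ forall i, closed_disk (z i), S \in unitmx,
      forall f, algB_generators N B f -> fnorm (node_matrix z S f) <= 1 &
      exists2 f, algB0 B f & sup_norm f < op_norm (node_rep z S f)].
Proof.
case: N => [|[|n]]// _ B_blaschke.
have [t /andP[t0 t1] gt] := test_factor_bound B_blaschke.
have [c [a [c1 a1 BE]]] := B_blaschke.
pose d := t ^+ 2; have d0 : 0 < d by rewrite exprn_gt0.
have d1 : d <= 1 by rewrite expr_le1// ltW.
have tau0 : 0 < (1 + d / 8)^-1 by rewrite invr_gt0 addr_gt0 ?divr_gt0.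
have tau1 : (1 + d / 8)^-1 < 1 by rewrite invf_lt1 ?ltrDl ?addr_gt0 ?divr_gt0.
have [||eps [w [S [/andP[eps0 eps4] [w1 wE] S_unit gens test]]]] :=
  @exists_fibre_matrices R[i] n c a ((1 + d / 8)^-1)%:C%C (4^-1)%:C%C c1 a1.
- by rewrite !ltcR tau0.
- by rewrite ltcR invr_gt0.
pose z (k : 'I_(1 + n.+2)) := match fintype.split k with inl _ => a 0 | inr i => w i end.
have z1 k : closed_disk (z k).
  by rewrite /z /closed_disk /=; case: fintype.split => ?; rewrite ltW//; exact: a1.
have Ba0 : B (a 0) = 0.
  rewrite BE; last exact: ltW (a1 0).
  apply/eqP; rewrite /blaschke mulf_eq0; apply/orP; right.
  by apply/prodf_eq0; exists 0; rewrite // subrr mul0r.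
have Bw i : B (w i) = eps by rewrite BE; [exact: wE|exact: ltW (w1 i)].
have node_valuesE f g : (forall i, f (w i) = eps * g i) -> f (a 0) = 0 ->
    \row_k f (z k) = row_mx 0 (eps *: \row_i g i) :> 'rV[R[i]]_(1 + n.+2).
  move=> fg fa; apply/rowP => k; rewrite !mxE /z.
  by case: fintype.split => i; rewrite !mxE.
exists _, z, S; split=> //.
  move=> _ [j /= jN <-]; rewrite /node_matrix.
  rewrite (node_valuesE (fun z => z ^+ j * B z) (fun i => w i ^+ j)) => [|i|].
  - exact: (gens (Ordinal jN)).
  - by rewrite Bw mulrC.
  - by rewrite Ba0 mulr0.
exists (fun z => B z * test_factor B t z); first exact: test_function_algB0.
apply: (@le_lt_trans _ _ (1 + d / 2)).
  apply: (@sup_norm_le R) => x x1; rewrite -lecR rnormE normrM.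
  by rewrite (le_trans _ (gt x x1))// ler_piMl// (blaschke_le1 B_blaschke).
have [er er0 erE] := gt0_real_complex eps0.
(* The Blaschke product takes the value eps on the fibre, so there the test
   factor is affine; the basis vector of the monomial 1 detects its value
   at 1. *)
pose h := d%:C%C * (B 1)^*.
pose e : euclid R (1 + n.+2) := delta_mx 0 (rshift 1 0).
have e1 : `|e| <= 1 by rewrite euclid_normE fnorm_delta_le1.
rewrite -ltcR; apply: lt_le_trans (op_norm_row_action_ge (node_matrix z S _) e1).
rewrite euclid_normE; apply: lt_le_trans (fnorm_coord _ (lshift n.+2 0)).
rewrite /row_action -rowE mxE /node_matrix.
rewrite (node_valuesE (fun z => B z * test_factor B t z)
  (fun i => (2^-1 - h * (eps - B 1)) + 2^-1 * w i)) => [|i|]; first last.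
- by rewrite Ba0 mul0r.
- by rewrite Bw /test_factor Bw -/d -/h; field.
rewrite test normrM ger0_norm ?ler0c ?(ltW tau0)//.
have -> : 2^-1 - h * (eps - B 1) + 2^-1 = (1 + d)%:C%C - h * eps.
  have BB : (B 1)^* * B 1 = 1.
    by rewrite mulrC -normCK (blaschke_norm1 B_blaschke) expr1n.
  have dE : d%:C%C = h * B 1 by rewrite /h -mulrA BB mulr1.
  by rewrite rmorphD /= rmorph1 dE; field.
apply: lt_le_trans (_ : ((1 + d / 8)^-1 * (1 + d - d * er))%:C%C <= _).
  by rewrite ltcR gap_inequality ?d0// -ltcR -erE.
rewrite rmorphM /= ler_wpM2l ?ler0c ?(ltW tau0)//.
apply: le_trans (lerB_dist _ _).
rewrite rmorphB /= ger0_norm ?ler0c ?addr_ge0 ?(ltW d0)// lerD2l lerN2.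
rewrite /h !normrM norm_conjC (blaschke_norm1 B_blaschke) mulr1 erE.
by rewrite !ger0_norm ?ler0c ?(ltW d0) ?(ltW er0)// -rmorphM.
Qed.

Theorem theorem7p4 (R : realType) (N : nat) (B : R[i] -> R[i])
    (N_ge2 : (2 <= N)%N) (B_blaschke : is_blaschke N B) :
  (exists (H : hilbertSpace R) (pi : (R[i] -> R[i]) -> (H -> H)),
    [/\ unital_representation (algB B) pi,
        forall f, algB_generators N B f -> contraction_operator (pi f) &
        ~ contractive_representation (algB B) pi]) /\
  (exists (H : hilbertSpace R) (pi : (R[i] -> R[i]) -> (H -> H)),
    [/\ unital_representation (algB0 B) pi,
        forall f, algB0_generators B f -> contraction_operator (pi f) &
        ~ contractive_representation (algB0 B) pi]).
Proof.
have [n [z [S [z1 S_unit gens [f f_algB0 f_gt]]]]] :=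
  exists_noncontractive_nodes N_ge2 B_blaschke.
have algB0_algB := algB0_sub B_blaschke.
have gens_contr g : algB_generators N B g -> contraction_operator (node_rep z S g).
  move=> Bg; split; first exact: row_action_bounded.
  by apply: op_norm_row_action_le; rewrite rmorph1; exact: gens.
split; exists (euclid_hilbert R n), (node_rep z S); split.
- apply: node_rep_unital => // g Bg w w1; exact (le_sup_norm B_blaschke Bg w1).
- exact: gens_contr.
- by move=> /(_ f (algB0_algB _ f_algB0)); rewrite leNgt f_gt.
- apply: node_rep_unital => // g /algB0_algB Bg w w1; exact (le_sup_norm B_blaschke Bg w1).
- by move=> g Bg; apply: gens_contr; exact: algB0_generator_gen Bg.
- by move=> /(_ f f_algB0); rewrite leNgt f_gt.
Qed.
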